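(* Let $q=2^h$ and let $t>2$. If $\mathcal{A}$ is an elation KM-arc of type $t$ in $\mathrm{PG}(2,q)$ with elation line $\ell_\infty: X=0$ and $t$-nucleus $N(0,0,1)$, then there is an additive subgroup $S$ of size $t$ in $\mathbb{F}_{q}$ such that for any $\alpha\in\mathbb{F}_{q}$ the set $\{z\in\mathbb{F}_q\mid(1,\alpha,z)\in\mathcal{A}\}$ is either empty or a coset of $S$. Vice versa, if for a KM-arc $\mathcal{A}$ of type $t$ in $\mathrm{PG}(2,q)$ there is an additive subgroup $S$ of size $t$ in $\mathbb{F}_{q}$ such that for any $\alpha\in\mathbb{F}_{q}$ the set $\{z\in\mathbb{F}_q\mid(1,\alpha,z)\in\mathcal{A}\}$ is either empty or a coset of $S$, then $\mathcal{A}$ is an elation KM-arc with elation line $X=0$ and $t$-nucleus $(0,0,1)$.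
   Context: Points of $\mathrm{PG}(2,q)$ have homogeneous coordinates $(X,Y,Z)$. A KM-arc of type $t$ in $\mathrm{PG}(2,q)$ is a set of $q+t$ points such that every line meets it in $0$, $2$ or $t$ points (each value occurring); a line meeting it in $i$ points is an $i$-secant. If $t>2$, all $t$-secants pass through one common point, the $t$-nucleus. An elation with axis a line $\ell$ and centre a point $R\in\ell$ is a collineation fixing all points of $\ell$ and stabilising all lines through $R$ (the identity is included). A KM-arc $\mathcal{A}$ of type $t>2$ is an elation KM-arc with elation line $\ell_\infty$ if for every $t$-secant $\ell\neq\ell_\infty$ the group of elations with axis $\ell_\infty$ stabilising $\mathcal{A}$ is transitive on the points of $\mathcal{A}\cap\ell$ (any point of $\mathcal{A}\cap\ell$ can be mapped to any other one by an element of the group). *)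

(* Defs.v *)
From HB Require Import structures.
From mathcomp Require Import all_boot all_order all_fingroup all_algebra.

Set Implicit Arguments.
Unset Strict Implicit.
Unset Printing Implicit Defensive.

Import GRing.Theory VectorInternalTheory.
Local Open Scope ring_scope.

HB.instance Definition _ (F : finFieldType) (vT : vectType F) :=
  [Countable of {vspace vT} by <:].
HB.instance Definition _ (F : finFieldType) (vT : vectType F) :=
  [Finite of {vspace vT} by <:].

Section ProjectivePlane.
Variable F : finFieldType.

Record point := Point {
  point_space :> {vspace 'rV[F]_3};
  point_dim : \dim point_space == 1%N }.

HB.instance Definition _ := [isSub for point_space].
HB.instance Definition _ := [Finite of point by <:].

Record line := Line {
  line_space :> {vspace 'rV[F]_3};
  line_dim : \dim line_space == 2 }.

HB.instance Definition _ := [isSub for line_space].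
HB.instance Definition _ := [Finite of line by <:].

Definition incident (P : point) (l : line) : bool :=
  (point_space P <= line_space l)%VS.

Definition points_on (l : line) : {set point} := [set P | incident P l].

Definition vec3 (x y z : F) : 'rV[F]_3 := \row_i [:: x; y; z]`_i.

Lemma vec3_neq0 x y z : [|| x != 0, y != 0 | z != 0] -> vec3 x y z != 0.
Proof.
apply: contraTneq => /rowP v0; rewrite !negb_or !negbK.
move: (v0 0) (v0 1) (v0 2%:R).
by rewrite !mxE /= => -> -> ->; rewrite eqxx.
Qed.

Lemma hpoint_subproof x y z :
  [|| x != 0, y != 0 | z != 0] -> \dim <[vec3 x y z]> == 1%N.
Proof. by move=> /vec3_neq0 nz; rewrite dim_vline nz. Qed.

Definition hpoint x y z (nz : [|| x != 0, y != 0 | z != 0]) : point :=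
  Point (hpoint_subproof nz).

Lemma affine_subproof (y z : F) : [|| 1 != 0 :> F, y != 0 | z != 0].
Proof. by rewrite oner_neq0. Qed.

Definition affine_point (y z : F) : point := hpoint (affine_subproof y z).

Lemma point001_subproof : [|| 0 != 0 :> F, 0 != 0 :> F | 1 != 0 :> F].
Proof. by rewrite oner_neq0 !orbT. Qed.

Definition point001 : point := hpoint point001_subproof.

Definition lineX0_space : {vspace 'rV[F]_3} :=
  lker (linfun (col 0 : 'rV[F]_3 -> 'cV[F]_1)).

Lemma mem_lineX0_space v : (v \in lineX0_space) = (v 0 0 == 0).
Proof.
rewrite memv_ker lfunE /=; apply/eqP/eqP => [/colP/(_ 0)|v0].
  by rewrite !mxE.
by apply/colP => i; rewrite !mxE ord1.
Qed.

Lemma lineX0_dim : \dim lineX0_space == 2.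
Proof.
have := limg_ker_dim (linfun (col 0 : 'rV[F]_3 -> 'cV[F]_1)) fullv.
rewrite capfv -/lineX0_space dimvf.
suff -> : limg (linfun (col 0 : 'rV[F]_3 -> 'cV[F]_1)) = fullv.
  by rewrite dimvf /dim /= => /eqP; rewrite -[(1 * 3)%N]/(2 + 1)%N eqn_add2r.
apply/vspaceP => w; rewrite memvf.
have -> : w = linfun (col 0 : 'rV[F]_3 -> 'cV[F]_1) (vec3 (w 0 0) 0 0).
  by rewrite lfunE /=; apply/colP => i; rewrite !mxE !ord1.
by rewrite memv_img ?memvf.
Qed.

Definition lineX0 : line := Line lineX0_dim.

Definition is_secant (A : {set point}) (i : nat) (l : line) : bool :=
  #|A :&: points_on l| == i.

Definition KM_arc (t : nat) (A : {set point}) : Prop :=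
  [/\ #|A| = (#|F| + t)%N,
      forall l, [|| is_secant A 0 l, is_secant A 2 l | is_secant A t l]
    & forall i, i \in [:: 0; 2; t]%N -> exists l, is_secant A i l].

(* N is the only point common to all t-secants. *)
Definition nucleus (t : nat) (A : {set point}) (N : point) : Prop :=
  forall P, P = N <-> (forall l, is_secant A t l -> incident P l).

(* A permutation of a finite point set that maps lines to lines also permutes
   the lines, so no separate condition is needed on the inverse. *)
Definition collineation (g : {perm point}) : bool :=
  [forall l : line, exists m : line, g @: points_on l == points_on m].

Definition elation (l : line) (R : point) (g : {perm point}) : bool :=
  [&& incident R l, collineation g,
      [forall P in points_on l, g P == P]
    & [forall m : line, incident R m ==> (g @: points_on m == points_on m)]].

Definition elations_with_axis (l : line) : {set {perm point}} :=
  [set g | [exists R, elation l R g]].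

Definition stab_elations (l : line) (A : {set point}) : {set {perm point}} :=
  [set g in elations_with_axis l | g @: A == A].

(* The elations may move A :&: points_on l to another part of A, so
   transitivity does not require them to stabilise it. *)
Definition elation_KM_arc (t : nat) (A : {set point}) (linf : line) : Prop :=
  [/\ (2 < t)%N, KM_arc t A
    & forall l, is_secant A t l -> l != linf ->
      {in A :&: points_on l &, forall P Q,
        exists2 g, g \in stab_elations linf A & g P = Q}].

Definition fibre (A : {set point}) (a : F) : {set F} :=
  [set z | affine_point a z \in A].

Definition is_coset (S B : {set F}) : Prop :=
  exists c, B = [set c + s | s in S].

End ProjectivePlane.

Arguments point001 {F}.
Arguments lineX0 {F}.

(* Main.v *)
Require Import Defs.
From mathcomp Require Import all_boot all_order all_fingroup all_algebra.
From mathcomp Require Import all_field zify ring.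

(** Counting the points of [A] along the lines through a point of [A] shows that
    exactly one of these lines is a [t]-secant, since
    [q + t - 1 = (q + 1) + (t - 2) * #(t-secants)]. An elation with axis [X = 0]
    that moves an affine point along a line through [N] has centre [N], so it is a
    translation [(1, y, z) |-> (1, y, z + c)]; the subgroup [S] consists of all [c]
    whose translation preserves the affine part of [A]. Conversely, if the fibres
    are cosets of [S], these translations extend to elations with centre [N]
    stabilising [A]; each vertical line meeting the affine part of [A] is a
    [t]-secant, so by uniqueness every [t]-secant passes through [N]. *)

Section Plane.

Set Implicit Arguments.
Unset Strict Implicit.

Import GRing.Theory.
Local Open Scope ring_scope.

Variable F : finFieldType.
Implicit Types (P Q R : point F) (l m : line F) (A B : {set point F}).
Implicit Types (y z c : F).

Local Notation N := (@point001 F).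
Local Notation linf := (@lineX0 F).

(** * Points, lines and joins *)

Lemma point_le P Q : (P <= Q)%VS -> P = Q.
Proof.
move=> PQ; apply/val_inj/eqP => /=.
by rewrite eqEdim PQ (eqP (point_dim P)) (eqP (point_dim Q)).
Qed.

Lemma line_le l m : (l <= m)%VS -> l = m.
Proof.
move=> lm; apply/val_inj/eqP => /=.
by rewrite eqEdim lm (eqP (line_dim l)) (eqP (line_dim m)).
Qed.

Lemma join_dim P Q : P != Q -> \dim (P + Q) == 2.
Proof.
move=> PQ; have := dimv_sum_cap P Q.
rewrite (eqP (point_dim P)) (eqP (point_dim Q)).
suff -> : \dim (P :&: Q) = 0%N by rewrite addn0 => ->.
apply/eqP; apply: contraNT PQ; rewrite -lt0n => d1.
apply/eqP/point_le; suff <- : (P :&: Q)%VS = P by rewrite capvSr.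
by apply/eqP; rewrite eqEdim capvSl (eqP (point_dim P)).
Qed.

Lemma line_join l P Q : P != Q -> incident P l -> incident Q l ->
  line_space l = (P + Q)%VS.
Proof.
rewrite /incident => PQ Pl Ql; apply/esym/eqP.
by rewrite eqEdim subv_add Pl Ql (eqP (join_dim PQ)) (eqP (line_dim l)).
Qed.

Lemma line_uniq l m P Q : P != Q -> incident P l -> incident Q l ->
  incident P m -> incident Q m -> l = m.
Proof.
move=> PQ Pl Ql Pm Qm.
by apply: val_inj => /=; rewrite (line_join PQ Pl Ql) (line_join PQ Pm Qm).
Qed.

Lemma exists_join P Q : P != Q -> exists2 l, incident P l & incident Q l.
Proof.
move=> PQ.
by exists (Line (join_dim PQ)); rewrite /incident (addvSl, addvSr).
Qed.

(** * Homogeneous coordinates and lines through [N] *)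

Lemma incidentE x y z (nz : [|| x != 0, y != 0 | z != 0]) l :
  incident (hpoint nz) l = (vec3 x y z \in line_space l).
Proof. by rewrite /incident /= -memvE. Qed.

Lemma affineE y z l : incident (affine_point y z) l = (vec3 1 y z \in line_space l).
Proof. exact: incidentE. Qed.

Lemma point001E l : incident N l = (vec3 0 0 1 \in line_space l).
Proof. exact: incidentE. Qed.

Lemma incident_linf (x y z : F) nz : incident (@hpoint F x y z nz) linf = (x == 0).
Proof. by rewrite incidentE mem_lineX0_space mxE. Qed.

Lemma affine_linf y z : incident (affine_point y z) linf = false.
Proof. by rewrite incident_linf oner_eq0. Qed.

Lemma point001_linf : incident N linf.
Proof. by rewrite incident_linf. Qed.

Lemma vec3_eta (v : 'rV[F]_3) : v = vec3 (v 0 0) (v 0 1) (v 0 2%:R).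
Proof.
apply/rowP => i; rewrite mxE; case: i => [[|[|[|]]] hi] //=;
by congr (v _ _); apply: val_inj.
Qed.

Lemma vec3D x1 y1 z1 x2 y2 z2 :
  vec3 x1 y1 z1 + vec3 x2 y2 z2 = vec3 (x1 + x2) (y1 + y2) (z1 + z2) :> 'rV[F]_3.
Proof. by apply/rowP => i; rewrite !mxE; case: i => [[|[|[|]]] hi]. Qed.

Lemma vec3Z k x y z : k *: vec3 x y z = vec3 (k * x) (k * y) (k * z) :> 'rV[F]_3.
Proof. by apply/rowP => i; rewrite !mxE; case: i => [[|[|[|]]] hi]. Qed.

Lemma vec3_inj x1 y1 z1 x2 y2 z2 : vec3 x1 y1 z1 = vec3 x2 y2 z2 :> 'rV[F]_3 ->
  [/\ x1 = x2, y1 = y2 & z1 = z2].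
Proof.
move=> /rowP e; move: (e 0) (e 1) (e 2%:R).
by rewrite !mxE /= => -> -> ->.
Qed.

Lemma affine_inj y z y' z' : affine_point y z = affine_point y' z' ->
  y = y' /\ z = z'.
Proof.
move=> e; have : vec3 1 y z \in point_space (affine_point y' z').
  by rewrite -e memv_line.
move=> /vlineP[k]; rewrite vec3Z => /vec3_inj[].
by rewrite mulr1 => <-; rewrite !mul1r.
Qed.

Lemma affineP P : ~~ incident P linf -> exists y z, P = affine_point y z.
Proof.
move=> Pl; set v := vpick P.
have v0 : v 0 0 != 0.
  apply: contra Pl => v0; have vN0 : v != 0.
    by rewrite vpick0 -dimv_eq0 (eqP (point_dim P)).
  rewrite /incident; suff <- : <[v]>%VS = P by rewrite -memvE mem_lineX0_space.
  apply/eqP; rewrite eqEdim -memvE memv_pick dim_vline vN0.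
  by rewrite (eqP (point_dim P)).
(* A vector spanning [P] is normalised to have first coordinate 1. *)
exists ((v 0 0)^-1 * v 0 1), ((v 0 0)^-1 * v 0 2%:R); apply/esym/point_le.
rewrite /= -memvE -[X in vec3 X _ _](mulVf v0) -vec3Z -vec3_eta.
by rewrite memvZ ?memv_pick.
Qed.

Lemma affine_neq y z P : incident P linf -> affine_point y z != P.
Proof. by apply: contraTneq => <-; rewrite affine_linf. Qed.

(** The line is spanned by [(1, y, z)] and [(0, 0, 1)], so its vectors with first coordinate 1 are
    exactly the [(1, y, z')]. *)
Lemma vertical_incident l y z y' z' : incident N l ->
  incident (affine_point y z) l -> incident (affine_point y' z') l = (y' == y).
Proof.
move=> Nl Pl; have PN := affine_neq y z point001_linf.
rewrite affineE; apply/idP/eqP => [|->].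
  rewrite (line_join PN Pl Nl) => /memv_addP[u /vlineP[j ->]].
  move=> [w /vlineP[k ->]]; rewrite !vec3Z vec3D => /vec3_inj[].
  by rewrite mulr1 !mulr0 !addr0 => <-; rewrite mul1r.
rewrite (_ : vec3 1 y z' = vec3 1 y z + (z' - z) *: vec3 0 0 1).
  by rewrite memvD ?memvZ -?affineE -?point001E.
by rewrite vec3Z vec3D !mulr0 mulr1 !addr0 addrC subrK.
Qed.

(** * Counting points and lines *)

Lemma card_vspace_nonzero (U : {vspace 'rV[F]_3}) :
  (#|[set v : 'rV[F]_3 | (v != 0%R) && (v \in U)]| + 1 = #|F| ^ \dim U)%N.
Proof.
rewrite -card_vspace [RHS](cardD1 (0 : 'rV[F]_3)) mem0v addnC; congr addn.
by apply: eq_card => v; rewrite !inE.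
Qed.

(** Double count of pairs of a point in [U] and a nonzero vector on it: a point carries [q - 1] such
    vectors, and a nonzero vector spans one point. *)
Lemma card_points_in (U : {vspace 'rV[F]_3}) :
  (#|[set P : point F | (P <= U)%VS]| * #|F|.-1 + 1 = #|F| ^ \dim U)%N.
Proof.
rewrite -card_vspace_nonzero; congr addn.
rewrite -sum_nat_const -[RHS]sum1_card.
have nonzero P : P \in [set P : point F | (P <= U)%VS] -> #|F|.-1 =
    (\sum_(v | (v \in [set v : 'rV[F]_3 | (v != 0%R) && (v \in U)]) &&
               (v \in point_space P)) 1)%N.
  rewrite inE => /subvP PU; rewrite sum1_card.
  have := card_vspace_nonzero P; rewrite (eqP (point_dim P)) expn1 addn1 => <-.
  apply: eq_card => v; rewrite [RHS]unfold_in /= !inE -andbA; congr andb.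
  by rewrite andb_idl // => /PU.
rewrite (eq_bigr _ nonzero).
rewrite (exchange_big_dep (mem [set v : 'rV[F]_3 | (v != 0%R) && (v \in U)])) /=;
  last by move=> P v _ /andP[].
apply: eq_bigr => v; rewrite inE => /andP[v0 vU]; rewrite sum1_card.
have dv : \dim <[v]> == 1%N by rewrite dim_vline v0.
rewrite (@eq_card _ _ (pred1 (Point dv))) ?card1 // => P.
rewrite [LHS]unfold_in !inE v0 vU /=; apply/idP/eqP => [/andP[_ vP]|->].
  by apply/esym/point_le; rewrite /= -memvE.
by rewrite /= memv_line -memvE vU.
Qed.

Lemma card_line_points l : #|points_on l| = #|F|.+1.
Proof.
have := card_points_in l; rewrite (eqP (line_dim l)).
rewrite -/(incident _ _) -/(points_on l).
(* With [q = n + 2] the factor [q - 1] becomes the positive [n.+1] and can be cancelled. *)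
case: #|F| (finNzRing_gt1 F) => [|[|n]] //= _ e.
apply/eqP; rewrite -(eqn_pmul2r (ltn0Sn n)) -(eqn_add2r 1) e; apply/eqP.
by rewrite -mulnn; lia.
Qed.

Lemma card_points : #|{: point F}| = (#|F| ^ 2 + #|F| + 1)%N.
Proof.
have := card_points_in fullv; rewrite dimvf /dim /= mul1n.
have -> : #|[set P : point F | (P <= fullv)%VS]| = #|{: point F}|.
  by apply: eq_card => P; rewrite !inE subvf.
case: #|F| (finNzRing_gt1 F) => [|[|n]] //= _ e.
apply/eqP; rewrite -(eqn_pmul2r (ltn0Sn n)) -(eqn_add2r 1) e; apply/eqP.
by rewrite !expnS expn0; lia.
Qed.

(** After exchanging the sums, each point of [B] is counted once, by its join with [P]. *)
Lemma sum_lines_through P B : P \notin B ->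
  (\sum_(l | incident P l) #|B :&: points_on l| = #|B|)%N.
Proof.
move=> PB; under eq_bigr do rewrite -sum1_card.
rewrite (exchange_big_dep (mem B)) /=; last first.
  by move=> l Q _; rewrite !inE => /andP[].
rewrite -[RHS]sum1_card; apply: eq_bigr => Q QB; rewrite sum1_card.
have PQ : P != Q by apply: contraNneq PB => ->.
have [l Pl Ql] := exists_join PQ.
rewrite (@eq_card _ _ (pred1 l)) ?card1 // => m.
rewrite [LHS]unfold_in !inE QB /=.
apply/andP/eqP => [[Pm Qm]|->]; first exact: (line_uniq PQ).
by rewrite Pl Ql.
Qed.

(** Take for [B] the complement of [P]: each line through [P] contributes [q] points, and the total
    is [q^2 + q = (q + 1) q]. *)
Lemma card_lines_through P : #|[set l | incident P l]| = #|F|.+1.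
Proof.
have PP : P \notin [set~ P] by rewrite !inE eqxx.
have := sum_lines_through PP; rewrite cardsC1 card_points.
rewrite (eq_bigr (fun=> #|F|)) => [|l Pl]; last first.
  have := cardsD1 P (points_on l); rewrite inE Pl card_line_points => -[->].
  by apply: eq_card => Q; rewrite !inE.
rewrite sum_nat_const addn1 /= -mulnn -mulSnr => /eqP.
rewrite eqn_pmul2r ?(ltnW (finNzRing_gt1 F)) // => /eqP <-.
by apply: eq_card => l; rewrite inE.
Qed.

(** * Secants of a KM-arc *)

Lemma secant_through_card t A P : (2 < t)%N -> KM_arc t A -> P \in A ->
  #|[set l | incident P l & is_secant A t l]| = 1%N.
Proof.
move=> t2 [cA secA _] PA.
have PP : P \notin A :\ P by rewrite !inE eqxx.
have := sum_lines_through PP; have := cardsD1 P A; rewrite PA cA => cP.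
(* A line through [P] is no 0-secant. Apart from [P], a 2-secant has one point of [A] and a
   [t]-secant has [t - 1 = 1 + (t - 2)]. *)
rewrite (eq_bigr (fun l => 1 + is_secant A t l * (t - 2))%N) => [|l Pl]; last first.
  have := cardsD1 P (A :&: points_on l); rewrite !inE PA Pl /=.
  have -> : (A :&: points_on l) :\ P = (A :\ P) :&: points_on l.
    by apply/setP => Q; rewrite !inE andbA.
  have := secA l; rewrite /is_secant; set n := #|_|; set k := #|_|.
  by move=> /or3P[] /eqP -> //; [rewrite (ltn_eqF t2) | rewrite eqxx] => e; lia.
rewrite big_split /= sum1_card -big_distrl /= -big_mkcondr /= sum1_card.
have -> : #|[pred l | incident P l & is_secant A t l]| =
    #|[set l | incident P l & is_secant A t l]| by apply: eq_card => l; rewrite !inE.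
have -> : #|[pred l | incident P l]| = #|F|.+1.
  by rewrite -(card_lines_through P); apply: eq_card => l; rewrite !inE.
move=> e; apply/eqP; rewrite -(@eqn_pmul2r (t - 2)) ?subn_gt0 //; apply/eqP.
rewrite mul1n; move: cP; rewrite -e; set u := (_ * _)%N; move: #|F| u => q u; lia.
Qed.

Lemma secant_through t A P : (2 < t)%N -> KM_arc t A -> P \in A ->
  exists l, [/\ incident P l, is_secant A t l
    & forall m, incident P m -> is_secant A t m -> m = l].
Proof.
move=> t2 kA PA; have /eqP/cards1P[l el] := secant_through_card t2 kA PA.
have /setP el' := el; have := el' l; rewrite !inE eqxx => /andP[Pl sl].
by exists l; split=> // m Pm sm; have := el' m; rewrite !inE Pm sm => /esym/eqP.
Qed.

Lemma KM_arc_line_le t A l : (2 < t)%N -> KM_arc t A ->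
  (#|A :&: points_on l| <= t)%N.
Proof.
by move=> t2 [_ /(_ l) + _]; rewrite /is_secant => /or3P[]/eqP-> //; apply: ltnW.
Qed.

Lemma KM_arc_not_sub_line t A l : (2 < t)%N -> KM_arc t A ->
  ~~ (A \subset points_on l).
Proof.
move=> t2 kA; apply/negP => /setIidPl Al; have := KM_arc_line_le l t2 kA.
rewrite Al; case: kA => -> _ _.
by rewrite leqNgt -[X in (X < _)%N]add0n ltn_add2r ltnW ?finNzRing_gt1.
Qed.

Lemma KM_arc_affine t A : (2 < t)%N -> KM_arc t A ->
  exists a z, affine_point a z \in A.
Proof.
move=> t2 kA; have /subsetPn[P PA] := KM_arc_not_sub_line linf t2 kA.
by rewrite inE => /affineP[a [z eP]]; exists a, z; rewrite -eP.
Qed.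

(** Otherwise [l] would share two points with [X = 0] and equal it, although it contains an affine
    point. *)
Lemma vertical_linf l a z P : incident N l -> incident (affine_point a z) l ->
  incident P l -> incident P linf -> P = N.
Proof.
move=> Nl al Pl Pi; apply: contraFeq (affine_linf a z) => PN.
by rewrite -(line_uniq PN Pl Nl Pi point001_linf).
Qed.

(** The points of [l] other than [N] are affine with second coordinate [a]. *)
Lemma vertical_card A l a z : incident N l -> incident (affine_point a z) l ->
  #|A :&: points_on l| = ((N \in A) + #|fibre A a|)%N.
Proof.
move=> Nl al; rewrite (cardsD1 N) !inE Nl andbT; congr addn.
rewrite -(card_imset (fibre A a) (f := affine_point a)); last first.
  by move=> z1 z2 /affine_inj[].
apply: eq_card => P; rewrite !inE; apply/idP/imsetP => [/and3P[PN PA Pl]|].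
  have [|y [w eP]] := @affineP P.
    by apply: contra PN => Pi; apply/eqP; apply: vertical_linf Nl al Pl Pi.
  move: PA Pl; rewrite eP (vertical_incident _ _ Nl al) => PA /eqP ya.
  by exists w; rewrite ?inE -ya.
case=> w; rewrite inE => wA ->.
by rewrite affine_neq ?point001_linf // wA (vertical_incident _ _ Nl al) eqxx.
Qed.

(** * Elations with axis [X = 0] *)

Section Elation.

Variables (g : {perm point F}) (R : point F).
Hypothesis elat : elation linf R g.

Lemma elation_fix P : incident P linf -> g P = P.
Proof.
by case/and4P: elat => _ _ /forallP/(_ P) /[swap] _ + Pi; rewrite inE Pi => /eqP.
Qed.

Lemma elation_stab l P : incident R l -> incident P l -> incident (g P) l.
Proof.
case/and4P: elat => _ _ _ /forallP/(_ l) /[swap] Rl; rewrite Rl => /eqP/setP/(_ (g P)).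
by rewrite mem_imset ?inE => [->|]; last exact: perm_inj.
Qed.

Lemma elation_line l : exists m, forall P, incident P l -> incident (g P) m.
Proof.
case/and4P: elat => _ /forallP/(_ l)/existsP[m /eqP/setP em] _ _; exists m => P Pl.
by have := em (g P); rewrite mem_imset ?inE ?Pl => [<-|]; last exact: perm_inj.
Qed.

(** The line through [R] and the affine point is stabilised, so it contains the distinct image point
    and is vertical. It meets the axis only in [N]. *)
Lemma elation_centre a z c : c != 0 ->
  g (affine_point a z) = affine_point a (z + c) -> R = N.
Proof.
move=> c0 gP; have Ri : incident R linf by case/and4P: elat.
have [l Pl Nl] := exists_join (affine_neq a z point001_linf).
have [m Pm Rm] := exists_join (affine_neq a z Ri).
have := elation_stab Rm Pm; rewrite gP => Qm.
have Ql : incident (affine_point a (z + c)) l by rewrite (vertical_incident _ _ Nl Pl).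
have PQ : affine_point a z != affine_point a (z + c).
  apply: contra_neq c0 => /affine_inj[_]; rewrite -{1}[z]addr0.
  by move/addrI.
by apply: (vertical_linf Nl Pl _ Ri); rewrite (line_uniq PQ Pl Ql Pm Qm).
Qed.

Hypothesis RN : R = N.

(* The image of [X] is the intersection of the line [NX] with the image of
   the line [PX], which is known since the latter meets the axis in a fixed point. *)
Lemma elation_translation_off a z0 c y z : y != a ->
  g (affine_point a z0) = affine_point a (z0 + c) ->
  g (affine_point y z) = affine_point y (z + c).
Proof.
move=> ya gP; have ya0 : y - a != 0 by rewrite subr_eq0.
(* [T] is the point at infinity of the line [l] joining [(1, a, z0)] to [(1, y, z)]; its coordinates
   are the difference of the two vectors. *)
have nzT : [|| 0 != 0 :> F, y - a != 0 | z - z0 != 0] by rewrite ya0 orbT.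
set T := hpoint nzT; have Ti : incident T linf by rewrite incident_linf.
have [l Pl Tl] := exists_join (affine_neq a z0 Ti).
have [m gm] := elation_line l.
have Xl : incident (affine_point y z) l.
  rewrite affineE (_ : vec3 1 y z = vec3 1 a z0 + vec3 0 (y - a) (z - z0)).
    by rewrite memvD -?affineE -?incidentE.
  by rewrite vec3D addr0 ![_ + (_ - _)]addrC !subrK.
have Xm := gm _ Xl; have := gm _ Pl; have := gm _ Tl.
rewrite gP (elation_fix Ti) => Tm Qm.
have Ym : incident (affine_point y (z + c)) m.
  rewrite affineE (_ : vec3 1 y (z + c) = vec3 1 a (z0 + c) + vec3 0 (y - a) (z - z0)).
    by rewrite memvD -?affineE -?incidentE.
  by rewrite vec3D addr0 [a + _]addrC subrK; congr vec3; ring.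
have [n Xn Nn] := exists_join (affine_neq y z point001_linf).
have Yn : incident (affine_point y (z + c)) n by rewrite (vertical_incident _ _ Nn Xn).
have gXn : incident (g (affine_point y z)) n by apply: elation_stab; rewrite ?RN.
(* Two distinct common points would make [m] equal to the vertical line [n]; but [m] contains the
   image of [(1, a, z0)], which would force [y = a]. *)
apply: contra_neq_eq ya => gXY; have mn := line_uniq gXY Xm Ym gXn Yn.
by apply/esym/eqP; rewrite -(vertical_incident a (z0 + c) Nn Xn) -mn.
Qed.

Lemma elation_translation a z0 c y z :
  g (affine_point a z0) = affine_point a (z0 + c) ->
  g (affine_point y z) = affine_point y (z + c).
Proof.
have [-> gP|ya] := eqVneq y a; last exact: elation_translation_off.
(* On the vertical line of the given point itself, the previous argument is applied twice, passing
   through [(1, a + 1, z0)]. *)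
have a1 : a + 1 != a by rewrite -subr_eq0 addrC addKr oner_eq0.
apply: (@elation_translation_off (a + 1) z0); first by rewrite eq_sym.
exact: elation_translation_off gP.
Qed.

End Elation.

(** * The subgroup of an elation KM-arc *)

Lemma elation_KM_arc_nucleus t A : nucleus t A N -> elation_KM_arc t A linf ->
  N \notin A.
Proof.
move=> nN [t2 kA _]; apply/negP => NA.
have [l [Nl sl ul]] := secant_through t2 kA NA.
have secN m : is_secant A t m -> incident N m by apply: (nN N).1.
(* As all [t]-secants pass through [N], [l] is the only one. Its points then lie on every
   [t]-secant, so by definition of the nucleus each of them is [N], against [t > 2]. *)
suff /subset_leq_card : A :&: points_on l \subset [set N].
  by rewrite cards1 (eqP sl) leqNgt (ltn_trans _ t2).
apply/subsetP => P; rewrite !inE => /andP[_ Pl]; apply/eqP/nN => m sm.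
by rewrite (ul m) ?secN.
Qed.

(** Asking for an equality of memberships, rather than an implication, lets it be read backwards,
    which gives closure under subtraction directly. *)
Definition shifts A : {set F} :=
  [set c | [forall y, forall z,
     (affine_point y (z + c) \in A) == (affine_point y z \in A)]].

Lemma shiftsP A c :
  reflect (forall y z, (affine_point y (z + c) \in A) = (affine_point y z \in A))
    (c \in shifts A).
Proof.
rewrite inE; apply: (iffP forallP) => [H y z|H y].
  by move/forallP/(_ z)/eqP: (H y).
by apply/forallP => z; rewrite H.
Qed.

Lemma shifts_zmod_closed A : GRing.zmod_closed (shifts A).
Proof.
split=> [|c d /shiftsP Hc /shiftsP Hd]; apply/shiftsP => y z; first by rewrite addr0.
by rewrite addrA -Hd subrK Hc.
Qed.

Lemma elation_KM_arc_fibre_sub t A a z1 z2 :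
    elation_KM_arc t A linf -> nucleus t A N ->
  z1 \in fibre A a -> z2 \in fibre A a -> z2 - z1 \in shifts A.
Proof.
move=> [t2 kA eA] nN; rewrite ![_ \in fibre _ _]inE => A1 A2.
(* A zero difference is treated apart, since only a point that moves determines the centre. *)
have [->|z12] := eqVneq z2 z1; first by apply/shiftsP => y z; rewrite subrr addr0.
have [l [l1 sl _]] := secant_through t2 kA A1.
have Nl : incident N l by apply: (nN N).1.
have l2 : incident (affine_point a z2) l by rewrite (vertical_incident _ _ Nl l1).
have llinf : l != linf by apply: contraTneq l1 => ->; rewrite affine_linf.
have [||g] := eA l sl llinf (affine_point a z1) (affine_point a z2).
- by rewrite !inE A1.
- by rewrite !inE A2.
rewrite 2!inE => /andP[/existsP[R gR] /eqP gA] g12.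
have g12' : g (affine_point a z1) = affine_point a (z1 + (z2 - z1)).
  by rewrite g12 addrC subrK.
have RN := elation_centre gR (_ : z2 - z1 != 0) g12'; rewrite subr_eq0 in RN.
apply/shiftsP => y z; rewrite -(elation_translation gR (RN z12) y z g12').
by rewrite -{1}gA mem_imset //; apply: perm_inj.
Qed.

Lemma elation_KM_arc_shifts t A :
    elation_KM_arc t A linf -> nucleus t A N ->
  #|shifts A| = t /\
  forall a, fibre A a = set0 \/ is_coset (shifts A) (fibre A a).
Proof.
move=> eA nN; have [t2 kA _] := eA.
have coset a z : z \in fibre A a -> fibre A a = [set z + c | c in shifts A].
  move=> za; apply/setP => w; apply/idP/imsetP => [wa|[c cS ->]].
    exists (w - z); first exact: elation_KM_arc_fibre_sub eA nN za wa.
    by rewrite addrC subrK.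
  by move: za; rewrite !inE (shiftsP _ _ cS).
split=> [|a]; last first.
  by have [->|[z za]] := set_0Vmem (fibre A a); [left | right; exists z; apply: coset].
have [a [z azA]] := KM_arc_affine t2 kA.
have za : z \in fibre A a by rewrite inE.
have [l [l1 sl _]] := secant_through t2 kA azA.
(* The [t]-secant through this point is vertical and [N] is not in [A], so its [t] points of [A] are
   those of the fibre. *)
have := vertical_card A ((nN N).1 erefl l sl) l1.
rewrite (eqP sl) (negPf (elation_KM_arc_nucleus nN eA)) (coset a z za) => ->.
by rewrite card_imset //; apply: addrI.
Qed.

(** * Shears and the elations they induce *)

Section Translation.

Variable s : F.

(** A transvection acting on row vectors from the right: it adds [c] times the first coordinate to
    the third, hence fixes [X = 0] pointwise and translates affine points by [c]. *)
Definition shear_mx (c : F) : 'M[F]_3 := 1%:M + c *: delta_mx 0 2%:R.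

Definition shear (c : F) : 'End('rV[F]_3) := linfun (mulmxr (shear_mx c)).

Lemma shearE c x y z : shear c (vec3 x y z) = vec3 x y (z + c * x).
Proof.
rewrite lfunE /= /shear_mx mulmxDr mulmx1 -scalemxAr.
have -> : vec3 x y z *m delta_mx 0 2%:R = vec3 0 0 x.
  apply/rowP => i; rewrite !mxE !big_ord_recl big_ord0 !mxE /=.
  by case: i => [[|[|[|]]] hi] //=; rewrite ?mulr0 ?mulr1 ?addr0.
by rewrite vec3Z vec3D !mulr0 !addr0.
Qed.

Lemma shearK c : cancel (shear c) (shear (- c)).
Proof. by move=> v; rewrite [v]vec3_eta !shearE mulNr addrK. Qed.

Lemma shear_dim (U : {vspace 'rV[F]_3}) : \dim (shear s @: U) = \dim U.
Proof.
apply: limg_dim_eq; suff /eqP -> : lker (shear s) == 0%VS by rewrite capv0.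
by apply/lker0P; apply: can_inj (shearK s).
Qed.

Definition shear_point P : point F :=
  @Point F (shear s @: P) (etrans (congr1 (eq_op^~ 1%N) (shear_dim P)) (point_dim P)).

Definition shear_line l : line F :=
  @Line F (shear s @: l) (etrans (congr1 (eq_op^~ 2) (shear_dim l)) (line_dim l)).

Lemma shear_point_inj : injective shear_point.
Proof.
move=> P Q /(congr1 val) /= PQ; apply/point_le/subvP => v vP.
have : shear s v \in (shear s @: Q)%VS by rewrite -PQ memv_img.
by case/memv_imgP => w wQ /(can_inj (shearK s)) ->.
Qed.

Definition shear_perm : {perm point F} := perm shear_point_inj.

(** One inclusion is enough: the map is injective and all lines have [q + 1] points. *)
Lemma shear_perm_line l : shear_perm @: points_on l = points_on (shear_line l).
Proof.
apply/eqP; rewrite eqEcard card_imset ?card_line_points ?leqnn ?andbT;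
  last exact: perm_inj.
apply/subsetP => _ /imsetP[P + ->]; rewrite !inE permE /incident /=; exact: limgS.
Qed.

Lemma shear_perm_affine y z : shear_perm (affine_point y z) = affine_point y (z + s).
Proof.
apply/esym/point_le; rewrite permE /= -memvE.
have -> : vec3 1 y (z + s) = shear s (vec3 1 y z) by rewrite shearE mulr1.
by rewrite memv_img ?memv_line.
Qed.

Lemma shear_perm_fix P : incident P linf -> shear_perm P = P.
Proof.
move=> Pi; apply: point_le; rewrite permE /=; apply/subvP => _ /memv_imgP[v vP ->].
have := subvP Pi v vP; rewrite mem_lineX0_space => /eqP v0.
by rewrite [v]vec3_eta shearE v0 mulr0 addr0 -v0 -vec3_eta.
Qed.

(** The shear changes a vector by a multiple of [(0, 0, 1)], which lies in [l]. *)
Lemma shear_line_fix l : incident N l -> shear_line l = l.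
Proof.
rewrite point001E => Nl; apply: line_le; apply/subvP => _ /memv_imgP[v vl ->].
rewrite [v]vec3_eta shearE (_ : vec3 _ _ _ = v + (s * v 0 0) *: vec3 0 0 1).
  by rewrite memvD ?memvZ.
by apply/esym; rewrite {1}[v]vec3_eta vec3Z vec3D !mulr0 !addr0 mulr1.
Qed.

Lemma shear_perm_elation : elation linf N shear_perm.
Proof.
apply/and4P; split; first exact: point001_linf.
- by apply/forallP => l; apply/existsP; exists (shear_line l); rewrite shear_perm_line.
- by apply/forallP => P; apply/implyP; rewrite inE => /shear_perm_fix ->.
- apply/forallP => l; apply/implyP => Nl.
  by rewrite shear_perm_line shear_line_fix.
Qed.

Lemma shear_perm_stab A : s \in shifts A -> shear_perm \in stab_elations linf A.
Proof.
move=> /shiftsP sA; rewrite !inE; apply/andP; split.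
  by apply/existsP; exists N; apply: shear_perm_elation.
rewrite eqEcard card_imset ?leqnn ?andbT; last exact: perm_inj.
apply/subsetP => _ /imsetP[P PA ->].
(* Points of [A] on the axis are fixed; affine ones stay in [A] because [s] is a shift. *)
have [/shear_perm_fix -> //|/affineP[y [z eP]]] := boolP (incident P linf).
by rewrite eP shear_perm_affine sA -eP.
Qed.

End Translation.

(** * KM-arcs whose fibres are cosets *)

Section CosetFibres.

Variables (t : nat) (A : {set point F}) (S : {set F}).
Hypotheses (t2 : (2 < t)%N) (kA : KM_arc t A).
Hypotheses (clS : GRing.zmod_closed S) (cardS : #|S| = t).
Hypothesis cosetS : forall a, fibre A a = set0 \/ is_coset S (fibre A a).

Lemma coset_fibre a z : z \in fibre A a -> exists c, fibre A a = [set c + s | s in S].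
Proof. by case: (cosetS a) => [->|//]; rewrite inE. Qed.

Lemma coset_fibre_card a z : z \in fibre A a -> #|fibre A a| = t.
Proof. by move=> /coset_fibre[c ->]; rewrite card_imset //; apply: addrI. Qed.

Lemma coset_fibre_sub a z w : z \in fibre A a -> w \in fibre A a -> w - z \in S.
Proof.
move=> za wa; have [c e] := coset_fibre za.
move: za wa; rewrite e => /imsetP[s1 S1 ->] /imsetP[s2 S2 ->].
by rewrite opprD addrACA subrr add0r; apply: clS.2.
Qed.

Lemma coset_fibre_add a z s : z \in fibre A a -> s \in S -> z + s \in fibre A a.
Proof.
move=> za sS; have [c e] := coset_fibre za; move: za; rewrite e => /imsetP[r rS ->].
by rewrite -addrA imset_f // (GRing.zmod_closedD clS).2.
Qed.

Lemma coset_shifts s : s \in S -> s \in shifts A.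
Proof.
move=> sS; have NsS : - s \in S by apply: (GRing.zmod_closedN clS).
apply/shiftsP => y z; have fibreE w : (affine_point y w \in A) = (w \in fibre A y).
  by rewrite inE.
rewrite !fibreE; apply/idP/idP => [zs|zy]; last exact: coset_fibre_add.
by rewrite -[z](addrK s); apply: coset_fibre_add.
Qed.

(** A vertical line through an affine point of [A] already has [t] points in the fibre; with [N] it
    would have [t + 1]. *)
Lemma coset_nucleus_notin : N \notin A.
Proof.
have [a [z azA]] := KM_arc_affine t2 kA.
have [l Pl Nl] := exists_join (affine_neq a z point001_linf).
have := KM_arc_line_le l t2 kA; rewrite (vertical_card A Nl Pl).
rewrite (@coset_fibre_card a z) ?inE //.
by case: (N \in A) => //; rewrite add1n ltnn.
Qed.

Lemma coset_vertical_secant l a z : incident N l -> incident (affine_point a z) l ->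
  affine_point a z \in A -> is_secant A t l.
Proof.
move=> Nl Pl PA; rewrite /is_secant (vertical_card A Nl Pl).
by rewrite (negPf coset_nucleus_notin) (@coset_fibre_card a z) ?inE.
Qed.

(** If [l] is not [X = 0], two points of [A] on it cannot both be at infinity. The vertical line
    through an affine one is a [t]-secant, so it is [l]. *)
Lemma coset_secant_nucleus l : is_secant A t l -> incident N l.
Proof.
move=> sl; have [->|ll] := eqVneq l linf; first exact: point001_linf.
have /card_gt1P[P [Q [+ + PQ]]] : (1 < #|A :&: points_on l|)%N.
  by rewrite (eqP sl) (ltn_trans _ t2).
rewrite !inE => /andP[PA Pl] /andP[QA Ql].
suff [a [z [azA azl]]] :
    exists a z, affine_point a z \in A /\ incident (affine_point a z) l.
  have [m Pm Nm] := exists_join (affine_neq a z point001_linf).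
  have sm := coset_vertical_secant Nm Pm azA.
  by have [k [_ _ uk]] := secant_through t2 kA azA; rewrite (uk l) // -(uk m).
have [Pi|/affineP[a [z eP]]] := boolP (incident P linf); last first.
  by exists a, z; rewrite -eP.
have [Qi|/affineP[a [z eQ]]] := boolP (incident Q linf); last first.
  by exists a, z; rewrite -eQ.
by rewrite (line_uniq PQ Pl Ql Pi Qi) eqxx in ll.
Qed.

Lemma coset_nucleus : nucleus t A N.
Proof.
move=> P; split=> [-> l|Psec]; first exact: coset_secant_nucleus.
apply: contraTeq isT => PN; have [a [z azA]] := KM_arc_affine t2 kA.
have [l [_ sl _]] := secant_through t2 kA azA.
(* A second point [P] on all [t]-secants would make each of them the line [PN]. As every point of
   [A] lies on a [t]-secant, [A] would be collinear. *)
suff Al : A \subset points_on l by have := KM_arc_not_sub_line l t2 kA; rewrite Al.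
apply/subsetP => Q QA; have [m [Qm sm _]] := secant_through t2 kA QA.
rewrite inE (line_uniq PN (Psec l sl) _ (Psec m sm)) //; exact: coset_secant_nucleus.
Qed.

Lemma coset_elation : elation_KM_arc t A linf.
Proof.
split=> // l sl ll P Q; rewrite !inE => /andP[PA Pl] /andP[QA Ql].
have Nl := coset_secant_nucleus sl.
(* [l] meets [X = 0] only in [N], which is not in [A], so its points of [A] are affine. *)
have affine R : R \in A -> incident R l -> exists a z, R = affine_point a z.
  move=> RA Rl; apply: affineP; apply: contraNN coset_nucleus_notin => Ri.
  rewrite -(_ : R = N) //; apply: contra_neq_eq ll => RN.
  exact: line_uniq RN Rl Nl Ri point001_linf.
have [a [z eP]] := affine P PA Pl; have [b [w eQ]] := affine Q QA Ql.
rewrite {}eP in PA Pl *; rewrite {}eQ in QA Ql *.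
move: Ql; rewrite (vertical_incident _ _ Nl Pl) => /eqP ba; rewrite {}ba in QA *.
(* Both points lie over [a], so [w - z] is a difference within one coset and belongs to [S]. *)
exists (shear_perm (w - z)); last by rewrite shear_perm_affine addrC subrK.
apply/shear_perm_stab/coset_shifts.
by apply: (@coset_fibre_sub a); rewrite inE.
Qed.

End CosetFibres.

End Plane.

Theorem lemma2p1 (F : finFieldType) (h t : nat) (A : {set point F}) :
  #|F| = 2 ^ h -> 2 < t ->
  (elation_KM_arc t A lineX0 /\ nucleus t A point001 ->
   exists S : {set F}, [/\ GRing.zmod_closed S, #|S| = t
     & forall alpha : F, fibre A alpha = set0 \/ is_coset S (fibre A alpha)])
  /\
  (KM_arc t A ->
   (exists S : {set F}, [/\ GRing.zmod_closed S, #|S| = t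
     & forall alpha : F, fibre A alpha = set0 \/ is_coset S (fibre A alpha)]) ->
   elation_KM_arc t A lineX0 /\ nucleus t A point001).
Proof.
move=> _ t2; split=> [[eA nN]|kA [S [clS cardS cosetS]]].
  have [cardS cosetS] := elation_KM_arc_shifts eA nN.
  by exists (shifts A); split=> //; apply: shifts_zmod_closed.
by split; [apply: coset_elation cosetS | apply: coset_nucleus cosetS].
Qed.
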